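(* Let $\mathcal X$ be a complex Banach space, let $A,B,C\in B(\mathcal X)$, and let $M_C=\begin{pmatrix} A & C\\ 0 & B\end{pmatrix}$ and $M_0=A\oplus B$, acting on $\mathcal X\oplus\mathcal X$. Then $$\sigma_{ab}(M_C)\subseteq\sigma_{ab}(M_0)\subseteq\sigma_{ab}(M_C)\cup\{\Xi^*_+(A)\cup\Xi_+(B)\}.$$
   Context: $B(\mathcal Y)$ is the algebra of bounded linear operators on a complex Banach space $\mathcal Y$; $T^*$ is the adjoint of $T$ acting on the dual space. For $T\in B(\mathcal Y)$ and $\lambda\in\mathbb C$, write $\lambda\in\Phi_+(T)$ ($T$ is upper semi-Fredholm at $\lambda$) if $(T-\lambda)\mathcal Y$ is closed and $\dim\ker(T-\lambda)<\infty$. The ascent $\mathrm{asc}(T-\lambda)$ is the least integer $n\ge 0$ with $\ker(T-\lambda)^n=\ker(T-\lambda)^{n+1}$ ($\infty$ if no such $n$ exists). The Browder essential approximate spectrum is $\sigma_{ab}(T)=\{\lambda\in\mathbb C:\lambda\notin\Phi_+(T)\text{ or }\mathrm{asc}(T-\lambda)=\infty\}$. $T$ has SVEP (the single-valued extension property) at $\lambda_0\in\mathbb C$ if for every open disc $\mathcal D$ centered at $\lambda_0$ the only analytic function $f:\mathcal D\to\mathcal Y$ with $(T-\lambda)f(\lambda)=0$ for all $\lambda\in\mathcal D$ is $f\equiv 0$. Define $\Xi_+(T)=\{\lambda\in\mathbb C:\lambda\notin\Phi_+(T)\text{ or }T\text{ does not have SVEP at }\lambda\}$ and $\Xi^*_+(T)=\{\lambda\in\mathbb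 C:\lambda\notin\Phi_+(T)\text{ or }T^*\text{ does not have SVEP at }\lambda\}$. *)

(* Defs.v *)
From HB Require Import structures.
From mathcomp Require Import all_boot all_order all_algebra.
From mathcomp Require Import complex.
From mathcomp Require Import all_classical all_reals all_analysis.

Set Implicit Arguments.
Unset Strict Implicit.
Unset Printing Implicit Defensive.
Import Order.TTheory GRing.Theory Num.Theory.
Import numFieldNormedType.Exports.
Local Open Scope classical_set_scope.
Local Open Scope complex_scope.
Local Open Scope ring_scope.

Section BoundedOperators.
Context {R : realType} (V W : normedModType R[i]).

Definition bounded_linear (f : V -> W) : Prop :=
  linear f /\ exists M : R[i], forall x, `|f x| <= M * `|x|.

Definition bounded_linear_pred : {pred V -> W} :=
  fun f => `[< bounded_linear f >].

Record bop := Bop {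
  bop_fun :> V -> W;
  bop_subproof : bop_fun \in bounded_linear_pred }.

HB.instance Definition _ := [isSub for bop_fun].
HB.instance Definition _ := [Choice of bop by <:].

Lemma bounded_linear_submod : submod_closed bounded_linear_pred.
Proof.
split=> [|a f g /asboolP[lf [M Mf]] /asboolP[lg [N Ng]]]; apply/asboolP.
  split=> [b x y|]; first by rewrite /= scaler0 addr0.
  by exists 0 => x; rewrite mul0r normr0.
split=> [b x y|].
  rewrite !fctE lf lg !scalerDr !scalerA mulrC -!addrA; congr (_ + _).
  by rewrite addrCA.
exists (`|a| * M + N) => x; rewrite !fctE (le_trans (ler_normD _ _))//.
by rewrite mulrDl lerD// normrZ -mulrA ler_wpM2l.
Qed.

HB.instance Definition _ :=
  GRing.isSubmodClosed.Build _ _ bounded_linear_pred bounded_linear_submod.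
HB.instance Definition _ := [SubChoice_isSubLmodule of bop by <:].

Lemma bopP (T : bop) : bounded_linear T.
Proof. by case: T => f /= /asboolP. Qed.

HB.instance Definition _ (T : bop) :=
  GRing.isLinear.Build _ _ _ _ (T : V -> W) (bopP T).1.

Definition mk_bop (f : V -> W) (bf : bounded_linear f) : bop :=
  Bop (asboolT bf).

Lemma bopE (S T : bop) : S =1 T -> S = T.
Proof. by move=> ST; apply/val_inj/funext. Qed.

End BoundedOperators.

Section OperatorNorm.
Context {R : realType} (V W : normedModType R[i]).
Implicit Types S T : bop V W.

Definition opnorm T : R :=
  sup [set complex.Re `|T x| | x in [set x : V | `|x| <= 1]].

Let normC (U : normedModType R[i]) (u : U) : (complex.Re `|u|)%:C = `|u|.
Proof. by rewrite RRe_real// ger0_real. Qed.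

Lemma bop_bounded T :
  exists2 M : R, 0 <= M & forall x, `|T x| <= M%:C * `|x|.
Proof.
have [_ [N TN]] := bopP T; exists (complex.Re `|N|) => [|x].
  by rewrite -ler0c (normC (N : R[i]^o)).
rewrite (normC (N : R[i]^o)).
have [->|x0] := eqVneq x 0; first by rewrite linear0 !normr0 mulr0.
rewrite (le_trans (TN x))// ler_wpM2r// real_ler_norm// realE; apply/orP; left.
by rewrite -(@pmulr_lge0 _ `|x|) ?normr_gt0// (le_trans _ (TN x)).
Qed.

Lemma bop_continuous T : continuous T.
Proof.
have [M M0 TM] := bop_bounded T; apply/linear_bounded_continuous.
apply/linear_boundedP; exists M%:C; split; first by apply/complex_realP; exists M.
by move=> r Mr x; rewrite (le_trans (TM x))// ler_wpM2r// ltW.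
Qed.

Lemma opnorm_has_sup T :
  has_sup [set complex.Re `|T x| | x in [set x : V | `|x| <= 1]].
Proof.
split; first by exists (complex.Re `|T 0|), 0; rewrite //= normr0.
have [M M0 TM] := bop_bounded T; exists M => _ [x /= x1 <-].
by rewrite -lecR normC (le_trans (TM x))// ler_piMr// ler0c.
Qed.

Lemma opnorm_ge0 T : 0 <= opnorm T.
Proof.
apply: (sup_upper_bound (opnorm_has_sup T)).
by exists 0; rewrite /= ?linear0 normr0.
Qed.

Lemma ler_opnorm T x : `|T x| <= (opnorm T)%:C * `|x|.
Proof.
have [->|x0] := eqVneq x 0; first by rewrite linear0 !normr0 mulr0.
rewrite -ler_pdivrMr ?normr_gt0// mulrC.
have nE (U : normedModType R[i]) (u : U) : `|x|^-1 * `|u| = `| `|x|^-1 *: u|.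
  by rewrite normrZ ger0_norm// invr_ge0.
rewrite nE -linearZ -[leLHS]normC lecR.
apply: (sup_upper_bound (opnorm_has_sup T)).
by exists (`|x|^-1 *: x); rewrite //= -nE mulVf// normr_eq0.
Qed.

Lemma opnorm_le T (M : R) : 0 <= M ->
  (forall x, `|T x| <= M%:C * `|x|) -> opnorm T <= M.
Proof.
move=> M0 TM; apply: ge_sup; first by case: (opnorm_has_sup T).
move=> _ [x /= x1 <-]; rewrite -lecR normC (le_trans (TM x))//.
by rewrite ler_piMr// ler0c.
Qed.

(* Norms on modules over R[i] take values in R[i], so the real number
   [opnorm T] is embedded; the topology of [bop V W], and hence of the dual
   space, is the operator-norm topology. *)
Let norm T : R[i] := (opnorm T)%:C.

Let ler_normD S T : norm (S + T) <= norm S + norm T.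
Proof.
rewrite /norm -rmorphD lecR; apply: opnorm_le => [|x].
  by rewrite addr_ge0// opnorm_ge0.
by rewrite rmorphD mulrDl (le_trans (ler_normD _ _))// lerD// ler_opnorm.
Qed.

Let opnormZ_le (a : R[i]) T : norm (a *: T) <= `|a| * norm T.
Proof.
rewrite /norm -(normC (a : R[i]^o)) -rmorphM lecR; apply: opnorm_le => [|x].
  by rewrite mulr_ge0 ?opnorm_ge0// -ler0c (normC (a : R[i]^o)).
rewrite -[X in X <= _]/(`|a *: T x|) normrZ rmorphM /= (normC (a : R[i]^o)) -mulrA.
by rewrite ler_wpM2l// ler_opnorm.
Qed.

Let normrZ (a : R[i]) T : norm (a *: T) = `|a| * norm T.
Proof.
apply/eqP; rewrite eq_le opnormZ_le/=.
have [->|a0] := eqVneq a 0; first by rewrite normr0 mul0r ler0c opnorm_ge0.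
rewrite -ler_pdivlMl ?normr_gt0// -normfV.
by have := opnormZ_le a^-1 (a *: T); rewrite scalerA mulVf// scale1r.
Qed.

Let normr0_eq0 T : norm T = 0 -> T = 0.
Proof.
move=> T0; apply: bopE => x; apply/eqP; rewrite -normr_le0.
by rewrite (le_trans (ler_opnorm T x))// -/(norm T) T0 mul0r.
Qed.

HB.instance Definition _ :=
  Lmodule_isNormed.Build R[i] (bop V W) ler_normD normrZ normr0_eq0.

Lemma bop_normE T : `|T| = (opnorm T)%:C.
Proof. by []. Qed.

End OperatorNorm.

Section Operators.
Context {R : realType}.
Implicit Types Y Z : normedModType R[i].

Lemma id_bounded_linear Y : bounded_linear (@idfun Y).
Proof. by split=> //; exists 1 => x; rewrite mul1r. Qed.

Definition id_bop Y : bop Y Y := mk_bop (id_bounded_linear Y).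

Definition sub_scalar Y (T : bop Y Y) (l : R[i]) : bop Y Y :=
  T - l *: id_bop Y.

Lemma sub_scalarE Y (T : bop Y Y) (l : R[i]) (y : Y) :
  sub_scalar T l y = T y - l *: y.
Proof. by []. Qed.

Definition dual Y : normedModType R[i] := bop Y R[i]^o.

Lemma comp_bounded_linear Y (T : bop Y Y) (phi : dual Y) :
  bounded_linear (fun y => phi (T y)).
Proof.
split=> [a x y|]; first by rewrite !linearP.
exists ((opnorm phi)%:C * (opnorm T)%:C) => x.
rewrite (le_trans (ler_opnorm phi _))// -mulrA ler_wpM2l ?ler0c ?opnorm_ge0//.
exact: ler_opnorm.
Qed.

Definition adjoint_fun Y (T : bop Y Y) (phi : dual Y) : dual Y :=
  mk_bop (comp_bounded_linear T phi).

Lemma adjoint_bounded_linear Y (T : bop Y Y) : bounded_linear (adjoint_fun T).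
Proof.
split=> [a phi psi|]; first exact: bopE.
exists (opnorm T)%:C => phi; rewrite !bop_normE -rmorphM lecR.
apply: opnorm_le => [|x]; first by rewrite mulr_ge0 ?opnorm_ge0.
rewrite (le_trans (ler_opnorm phi _))// [opnorm T * _]mulrC rmorphM /= -mulrA.
by rewrite ler_wpM2l ?ler0c ?opnorm_ge0// ler_opnorm.
Qed.

Definition adjoint Y (T : bop Y Y) : bop (dual Y) (dual Y) :=
  mk_bop (adjoint_bounded_linear T).

Lemma adjointE Y (T : bop Y Y) (phi : dual Y) (y : Y) :
  (adjoint T phi : dual Y) y = phi (T y).
Proof. by []. Qed.

(* The direct sum of Y with itself is the product normed module [Y * Y], with
   the maximum norm; other usual norms on the sum are equivalent to it. *)
Lemma upper_triangular_bounded_linear Y (A C B : bop Y Y) :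
  bounded_linear (fun u : Y * Y => (A u.1 + C u.2, B u.2)).
Proof.
split=> [a [x1 x2] [y1 y2]|].
  have D (x1' x2' y1' y2' : Y) :
    a *: (x1', x2') + (y1', y2') = (a *: x1' + y1', a *: x2' + y2') by [].
  by rewrite !D /= !linearP scalerDr addrACA.
exists ((opnorm A)%:C + (opnorm C)%:C + (opnorm B)%:C) => -[x y].
have le1 (T : bop Y Y) : `|T x| <= (opnorm T)%:C * `|(x, y)|.
  rewrite (le_trans (ler_opnorm T x))// ler_wpM2l ?ler0c ?opnorm_ge0//.
  by rewrite prod_normE comparable_le_max ?real_comparable//= lexx.
have le2 (T : bop Y Y) : `|T y| <= (opnorm T)%:C * `|(x, y)|.
  rewrite (le_trans (ler_opnorm T y))// ler_wpM2l ?ler0c ?opnorm_ge0//.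
  by rewrite prod_normE comparable_le_max ?real_comparable//= lexx orbT.
rewrite [leLHS]prod_normE comparable_ge_max ?real_comparable//= !mulrDl; apply/andP; split.
  rewrite -[leLHS]addr0 lerD//; last by rewrite mulr_ge0// ler0c opnorm_ge0.
  by rewrite (le_trans (ler_normD _ _))// lerD.
by rewrite -[leLHS]add0r lerD// addr_ge0// mulr_ge0// ler0c opnorm_ge0.
Qed.

Definition upper_triangular Y (A C B : bop Y Y) :
    bop (Y * Y)%type (Y * Y)%type :=
  mk_bop (upper_triangular_bounded_linear A C B).

Lemma direct_sum_bounded_linear Y (A B : bop Y Y) :
  bounded_linear (fun u : Y * Y => (A u.1, B u.2)).
Proof.
have [l [M AB]] := upper_triangular_bounded_linear A 0 B.
have E (u : Y * Y) : (A u.1 + (0 : bop Y Y) u.2, B u.2) = (A u.1, B u.2).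
  by rewrite addr0.
split=> [a u v|]; first by rewrite -!E l.
by exists M => u; rewrite -E.
Qed.

Definition direct_sum Y (A B : bop Y Y) : bop (Y * Y)%type (Y * Y)%type :=
  mk_bop (direct_sum_bounded_linear A B).

Lemma upper_triangular0 Y (A B : bop Y Y) :
  upper_triangular A 0 B = direct_sum A B.
Proof. by apply: bopE => u /=; rewrite addr0. Qed.

Definition ker_pow Y (T : bop Y Y) (n : nat) : set Y :=
  [set y | iter n T y = 0].

Definition finite_dimensional Y (E : set Y) : Prop :=
  exists n (v : 'I_n -> Y),
    E = [set \sum_(i < n) c i *: v i | c in [set: 'I_n -> R[i]]].

Definition Phi_plus Y (T : bop Y Y) : set R[i] :=
  [set l | closed (range (sub_scalar T l)) /\
           finite_dimensional [set y | sub_scalar T l y = 0]].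

(* None stands for an infinite ascent. *)
Definition ascent Y (T : bop Y Y) : option nat :=
  if pselect (exists n, `[< ker_pow T n = ker_pow T n.+1 >]) is left ex
  then Some (ex_minn ex) else None.

Lemma ascent_None Y (T : bop Y Y) :
  ascent T = None <-> forall n, ker_pow T n <> ker_pow T n.+1.
Proof.
rewrite /ascent; case: pselect => [ex|nex]; split => //.
  by move=> nT; exfalso; case: ex => n /asboolP /nT.
by move=> _ n Tn; apply: nex; exists n; apply/asboolP.
Qed.

Lemma ascent_Some Y (T : bop Y Y) n :
  ascent T = Some n <-> ker_pow T n = ker_pow T n.+1 /\
    forall m, ker_pow T m = ker_pow T m.+1 -> (n <= m)%N.
Proof.
rewrite /ascent; case: pselect => [ex|nex]; split => //.
- case=> <-; case: ex_minnP => k /asboolP Tk kmin; split=> // m Tm.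
  by apply: kmin; apply/asboolP.
- case=> Tn nmin; congr Some; case: ex_minnP => k /asboolP Tk kmin.
  by apply/eqP; rewrite eqn_leq nmin// kmin//; apply/asboolP.
- by case=> Tn; exfalso; apply: nex; exists n; apply/asboolP.
Qed.

Definition sigma_ab Y (T : bop Y Y) : set R[i] :=
  [set l | ~ Phi_plus T l \/ ascent (sub_scalar T l) = None].

Definition open_disc (l : R[i]) (r : R) : set R[i] :=
  [set z | `|z - l| < r%:C].

(* For D open, Banach-space-valued analyticity is complex differentiability:
   the filter in [derivable] is that of punctured neighbourhoods of 0 in R[i].
   Only the values of f on D matter. *)
Definition analytic_on Y (D : set R[i]) (f : R[i] -> Y) : Prop :=
  forall z, D z -> derivable (f : R[i]^o -> Y) z 1.

Definition SVEP Y (T : bop Y Y) (l0 : R[i]) : Prop :=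
  forall r : R, 0 < r -> forall f : R[i] -> Y,
    analytic_on (open_disc l0 r) f ->
    (forall l, open_disc l0 r l -> sub_scalar T l (f l) = 0) ->
    forall l, open_disc l0 r l -> f l = 0.

Definition Xi_plus Y (T : bop Y Y) : set R[i] :=
  [set l | ~ Phi_plus T l \/ ~ SVEP T l].

Definition Xi_plus_star Y (T : bop Y Y) : set R[i] :=
  [set l | ~ Phi_plus T l \/ ~ SVEP (adjoint T) l].

End Operators.

(* Main.v *)
(* The SVEP of [B] at [l] forces [B - l] to have finite ascent: an
   upper semi-Fredholm [S] of infinite ascent has a backward orbit
   [S a_(n+1) = a_n], [S a_0 = 0], [a_0 <> 0], of at most geometric growth, and
   [sum_n z^n a_n] is then a nonzero analytic family of eigenvectors.
   Since [asc A <= asc M_C <= asc A + asc B], the rest amounts to [M_C] being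
   upper semi-Fredholm when [A] and [B] are. By the open mapping theorem for
   [B], the range of [M_C] is closed because [range A + C (ker B)], the sum of a
   closed and a finite-dimensional subspace, is closed. *)
Require Import Defs.
From mathcomp Require Import all_boot all_order all_algebra.
From mathcomp Require Import complex lra ring.
From mathcomp Require Import all_classical all_reals all_analysis.
Set Implicit Arguments.
Unset Strict Implicit.
Unset Printing Implicit Defensive.
Import Order.TTheory GRing.Theory Num.Theory.
Import numFieldNormedType.Exports.
Local Open Scope classical_set_scope.
Local Open Scope complex_scope.
Local Open Scope ring_scope.

(** * The real-valued norm *)

Section RealNorm.
Context {R : realType}.

(** The ascent of [B] is what [M_C] does not reveal: the first summand is invariant under [M_C], so
    finite ascent passes to [A], but the second one is in general not invariant when [C] is nonzero,
    and SVEP has to take over. The obstacle to a backward orbit is that a preimage chosen at random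
    may itself have no preimage. The choices are therefore made in the intersection of the ranges of
    all powers of [S]. Because [ker S] is finite-dimensional, its traces on these ranges become
    stationary, and this makes [S] map the intersection onto itself. The open mapping theorem is
    needed there too, hence its form for an operator restricted to a closed subspace with closed
    image. Limits are arranged so that the error bound at least halves at each step, which lets one
    convergence lemma serve for nested balls, successive approximation and power series. *)

Definition rnorm {V : normedZmodType R[i]} (x : V) : R := complex.Re `|x|.

Section NormedZmod.
Context {V : normedZmodType R[i]}.
Implicit Types x y z : V.

(** Norms take values in [R[i]], whose order is only partial; passing to [R] opens estimates to
    [lra] and [nra]. *)
Lemma rnormE x : `|x| = (rnorm x)%:C.
Proof. by rewrite /rnorm RRe_real// ger0_real. Qed.

Lemma rnorm_ge0 x : 0 <= rnorm x.
Proof. by rewrite -ler0c -rnormE. Qed.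

Lemma rnorm0 : rnorm (0 : V) = 0.
Proof. by rewrite /rnorm normr0. Qed.

Lemma rnorm_eq0 x : rnorm x = 0 -> x = 0.
Proof. by move=> x0; apply/normr0_eq0; rewrite rnormE x0. Qed.

Lemma rnormN x : rnorm (- x) = rnorm x.
Proof. by rewrite /rnorm normrN. Qed.

Lemma rnormD x y : rnorm (x + y) <= rnorm x + rnorm y.
Proof. by rewrite -lecR rmorphD /= -!rnormE ler_normD. Qed.

Lemma rnormC x y : rnorm (x - y) = rnorm (y - x).
Proof. by rewrite -rnormN opprB. Qed.

Lemma rnormB x y : rnorm (x - y) <= rnorm x + rnorm y.
Proof. by rewrite -(rnormN y) rnormD. Qed.

Lemma rnorm_tri y x z : rnorm (x - z) <= rnorm (x - y) + rnorm (y - z).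
Proof. by rewrite -[x - z](subrKA y) rnormD. Qed.

Lemma rnorm_gt0 x : x <> 0 -> 0 < rnorm x.
Proof.
by move=> x0; rewrite lt_def rnorm_ge0 andbT; apply/eqP => /rnorm_eq0.
Qed.

End NormedZmod.

Lemma rnormZ (V : normedModType R[i]) (c : R[i]) (x : V) :
  rnorm (c *: x) = rnorm c * rnorm x.
Proof.
by apply: (@complexI R); rewrite rmorphM /= -!rnormE normrZ.
Qed.

Lemma rnormM (a b : R[i]) : rnorm (a * b) = rnorm a * rnorm b.
Proof. exact: (@rnormZ R[i]^o). Qed.

Lemma rnormX (a : R[i]) n : rnorm (a ^+ n) = rnorm a ^+ n.
Proof.
elim: n => [|n IH]; first by rewrite !expr0 /rnorm normr1.
by rewrite !exprS rnormM IH.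
Qed.

Lemma rnorm_real (a : R) : rnorm (a%:C) = `|a|.
Proof. by rewrite /rnorm normc_def /= expr0n addr0 sqrtr_sqr. Qed.

Lemma rnormV (a : R[i]) : rnorm a^-1 = (rnorm a)^-1.
Proof. by apply: (@complexI R); rewrite -rnormE normfV rnormE fmorphV. Qed.

Lemma gt0_realC (e : R[i]) : 0 < e -> exists2 d : R, 0 < d & e = d%:C.
Proof.
move=> e0; have E : (complex.Re e)%:C = e by rewrite RRe_real// gtr0_real.
by exists (complex.Re e) => //; rewrite -ltcR E.
Qed.

Lemma nbhs_rnormP (V : normedModType R[i]) (x : V) (P : set V) :
  nbhs x P <-> exists2 e : R, 0 < e & forall y, rnorm (x - y) < e -> P y.
Proof.
split=> [/nbhs_ballP[_ /gt0_realC[e e0 ->] xP]|[e e0 xP]].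
  by exists e => // y xy; apply: xP; rewrite -ball_normE/= rnormE ltcR.
apply/nbhs_ballP; exists e%:C; first by rewrite /= ltcR.
by move=> y; rewrite -ball_normE/= rnormE ltcR; exact: xP.
Qed.

Lemma closed_rnormP (V : normedModType R[i]) (F : set V) :
  closed F <->
  forall x, (forall e : R, 0 < e -> exists2 y, F y & rnorm (x - y) < e) -> F x.
Proof.
split=> Fc x xF; apply: Fc.
  move=> B /nbhs_rnormP[e e0 xB]; have [y Fy xy] := xF e e0.
  by exists y; split=> //; apply: xB.
move=> e e0; have [|y [Fy xy]] := xF [set y | rnorm (x - y) < e].
  by apply/nbhs_rnormP; exists e.
by exists y.
Qed.

(** A common interface for Banach spaces and for the scalars [R[i]]. The explicit rate [b] survives
    as the error bound of the limit. *)
Definition seq_complete (V : normedZmodType R[i]) : Prop :=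
  forall (u : nat -> V) (b : nat -> R),
    (forall m n, (m <= n)%N -> rnorm (u n - u m) <= b m) ->
    (forall e : R, 0 < e -> exists n, b n < e) ->
    exists l, forall n, rnorm (u n - l) <= b n.

Lemma complete_lim (K : numFieldType) (V : completeNormedModType K)
    (u : nat -> V) (b : nat -> K) :
    (forall m n, (m <= n)%N -> `|u n - u m| <= b m) ->
    (forall e : K, 0 < e -> exists n, b n < e) ->
  exists l, forall n, `|u n - l| <= b n.
Proof.
move=> ub b0.
have /cauchy_cvgP/cvg_ex[l ul] : cauchy (u @ \oo).
  apply: cauchy_exP => e e0; have [n bn] := b0 e e0.
  exists (u n); exists n => // m /= nm.
  by rewrite -ball_normE /= distrC (le_lt_trans _ bn)// ub.
exists l => n.
apply/ler_addgt0Pr => e e0; move/cvgrPdist_lt: ul => /(_ e e0)[m _ mP].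
have := mP (maxn m n); rewrite /= leq_maxl => /(_ isT) ule.
rewrite -[u n - l](subrKA (u (maxn m n))) (le_trans (ler_normD _ _))//.
by rewrite lerD// distrC// ?ub ?leq_maxr// ltW.
Qed.

Lemma seq_complete_normed (V : completeNormedModType R[i]) : seq_complete V.
Proof.
move=> u b ub b0.
have [||l lP] := @complete_lim _ V u (fun n => (b n)%:C).
- by move=> m n mn; rewrite rnormE lecR ub.
- by move=> _ /gt0_realC[e e0 ->]; have [n bn] := b0 e e0; exists n; rewrite ltcR.
by exists l => n; rewrite -lecR -rnormE.
Qed.

Lemma rnorm_Re (z : R[i]) : `|complex.Re z| <= rnorm z.
Proof. by rewrite -lecR -rnormE normc_ge_Re. Qed.

Lemma rnorm_Im (z : R[i]) : `|complex.Im z| <= rnorm z.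
Proof.
have -> : rnorm z = Num.sqrt (complex.Re z ^+ 2 + complex.Im z ^+ 2).
  by rewrite /rnorm normc_def.
by rewrite -sqrtr_sqr ler_wsqrtr// lerDr sqr_ge0.
Qed.

Lemma rnorm_ReIm (z : R[i]) : rnorm z <= `|complex.Re z| + `|complex.Im z|.
Proof.
rewrite [z in rnorm z]complexE (le_trans (rnormD _ _))// rnormM !rnorm_real.
have -> : rnorm ('i : R[i]) = 1.
  by rewrite /rnorm normc_def /= expr0n expr1n add0r sqrtr1.
by rewrite mul1r.
Qed.

Lemma seq_complete_scalars : seq_complete R[i].
Proof.
move=> u b ub b0.
have part (g : {additive R[i] -> R}) : (forall z, `|g z| <= rnorm z) ->
    exists l, forall n, `|g (u n) - l| <= b n.
  move=> gle; apply: (@complete_lim _ R^o) => // m n mn.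
  by rewrite -raddfB (le_trans (gle _))// ub.
have [a aP] := part (@complex.Re R) rnorm_Re.
have [c cP] := part (@complex.Im R) rnorm_Im.
exists (a +i* c)%C => n.
(* Treating the two coordinates separately costs a factor 2. Comparing with a later term, through an
   index [m] where [b m] is tiny, brings the bound back to [b n]; the error is [3 * b m], hence
   [e / 3]. *)
have ul m : rnorm (u m - (a +i* c)%C) <= 2 * b m.
  rewrite (le_trans (rnorm_ReIm _))// mulr2n mulrDl mul1r lerD//.
    by rewrite raddfB; exact: aP.
  by rewrite raddfB; exact: cP.
apply/ler_addgt0Pr => e e0; have [|m bm] := b0 (e / 3); first lra.
have := rnorm_tri (u (maxn m n)) (u n) (a +i* c)%C.
have := rnorm_tri (u m) (u (maxn m n)) (a +i* c)%C.
have := ul m; have := ub _ _ (leq_maxl m n); have := ub _ _ (leq_maxr m n).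
rewrite (rnormC (u n) (u (maxn m n))); lra.
Qed.

Lemma geometric_half_lt (r e : R) : 0 < e -> exists n, r * 2^-1 ^+ n < e.
Proof.
move=> e0; pose n := (Num.truncn (r / e)).+1; exists n.
rewrite exprVn ltr_pdivrMr ?exprn_gt0// mulrC -ltr_pdivrMr//.
apply: (lt_trans (truncnS_gt _)).
by rewrite -natrX ltr_nat ltn_expl.
Qed.

(** A step of size at most [r n / 2] is paid for by the drop [r n - r n.+1], so distances telescope
    and [r n] bounds the whole tail. *)
Lemma halving_lim (V : normedZmodType R[i]) (u : nat -> V) (r : nat -> R) :
    seq_complete V -> (forall n, 0 <= r n) ->
    (forall n, r n.+1 <= r n / 2) ->
    (forall n, rnorm (u n.+1 - u n) <= r n / 2) ->
  exists l, forall n, rnorm (u n - l) <= r n.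
Proof.
move=> Vc r0 rS uS.
have ur m k : rnorm (u (m + k)%N - u m) <= r m - r (m + k)%N.
  elim: k => [|k IH]; first by rewrite addn0 !subrr rnorm0.
  rewrite addnS.
  have := rnorm_tri (u (m + k)%N) (u (m + k).+1) (u m).
  have := uS (m + k)%N; have := rS (m + k)%N; lra.
apply: Vc => [m n mn|e e0].
  have := ur m (n - m)%N; rewrite subnKC//; have := r0 n; lra.
have r2 n : r n <= r 0%N * 2^-1 ^+ n.
  elim: n => [|n IH]; first by rewrite expr0 mulr1.
  by rewrite exprS; have := rS n; lra.
have [n nP] := geometric_half_lt (r 0%N) e0.
by exists n; apply: le_lt_trans (r2 n) _.
Qed.

End RealNorm.

(** * Finite-dimensional subspaces *)

Section Subspaces.
Context {R : realType} {V : normedModType R[i]}.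
Implicit Types (M E : set V) (s : seq V) (x y : V).

Definition is_subspace M : Prop :=
  M 0 /\ forall a x y, M x -> M y -> M (a *: x + y).

Section Closure.
Variables (M : set V) (subM : is_subspace M).

Lemma subspaceD x y : M x -> M y -> M (x + y).
Proof. by move=> Mx My; rewrite -[x]scale1r; exact: subM.2. Qed.

Lemma subspaceZ a x : M x -> M (a *: x).
Proof. by move=> Mx; rewrite -[_ *: _]addr0; apply: subM.2 => //; exact: subM.1. Qed.

Lemma subspaceN x : M x -> M (- x).
Proof. by rewrite -scaleN1r; exact: subspaceZ. Qed.

Lemma subspaceB x y : M x -> M y -> M (x - y).
Proof. by move=> Mx /subspaceN; exact: subspaceD. Qed.

End Closure.

Lemma subspace0 : is_subspace [set 0].
Proof. by split=> // a x y /= -> ->; rewrite scaler0 addr0. Qed.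

Lemma subspaceT : is_subspace [set: V].
Proof. by []. Qed.

Lemma subspaceI M E : is_subspace M -> is_subspace E -> is_subspace (M `&` E).
Proof.
move=> [M0 MS] [E0 ES]; split=> // a x y [Mx Ex] [My Ey].
by split; [exact: MS|exact: ES].
Qed.

(* The sum of the subspace [M] and the span of [s]. *)
Fixpoint lspan M s : set V :=
  if s is v :: s' then [set x | exists c, lspan M s' (x - c *: v)] else M.

Lemma lspan_subspace M s : is_subspace M -> is_subspace (lspan M s).
Proof.
move=> subM; elim: s => [|v s subs] //=; split=> [|a x y [c cx] [d dy]].
  by exists 0; rewrite scale0r subr0; exact: subs.1.
exists (a * c + d); have := subs.2 a _ _ cx dy; congr lspan.
by rewrite scalerBr scalerA scalerDl opprD addrACA.
Qed.

Lemma lspanP M s x :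
  lspan M s x <-> exists2 y, lspan [set 0] s y & M (x - y).
Proof.
elim: s x => [|v s IH] x /=.
  by split=> [Mx|[_ ->]]; [exists 0; rewrite ?subr0|rewrite subr0].
split=> [[c /IH[y ys My]]|[y [c ys] My]].
  by exists (y + c *: v); [exists c; rewrite addrK|rewrite opprD addrA addrAC].
by exists c; apply/IH; exists (y - c *: v) => //; rewrite opprB subrKA.
Qed.

(** One step of Gaussian elimination: modulo the span of [s], the pivot [e] has coordinate [c] along
    [v], and subtracting [(d / c) *: e] cancels the coordinate [d] of [x]. *)
Lemma lspan_eliminate s (c d : R[i]) (v e x : V) : c != 0 ->
  lspan [set 0] s (e - c *: v) -> lspan [set 0] s (x - d *: v) ->
  lspan [set 0] s (x - (d / c) *: e).
Proof.
move=> c0 ec dx.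
have -> : x - (d / c) *: e = (- (d / c)) *: (e - c *: v) + (x - d *: v).
  rewrite scalerBr scalerA mulNr divfK// !scaleNr opprK.
  by rewrite [RHS]addrACA subrr addr0 addrC.
exact: (lspan_subspace s subspace0).2.
Qed.

(** Either some [e] in [E] has a nonzero [v]-coordinate, and [E] is the line of [e] plus the part of
    [E] in the span of [s], or [E] already lies in that span. *)
Lemma subspace_lspan s E : is_subspace E -> E `<=` lspan [set 0] s ->
  exists t, E = lspan [set 0] t.
Proof.
elim: s E => [|v s IH] E subE Es.
  by exists [::]; apply/seteqP; split=> //= x ->; exact: subE.1.
have [[e [Ee [c [c0 ec]]]]|nE] :=
    pselect (exists e, E e /\ exists c, c != 0 /\ lspan [set 0] s (e - c *: v)).
  have subs := lspan_subspace s subspace0.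
  have [|t Et] := IH _ (subspaceI subE subs); first exact: subIsetr.
  exists (e :: t); rewrite /= -Et; apply/seteqP; split=> x /=; last first.
    by move=> [d [Ed _]]; rewrite -[x](subrK (d *: e)) addrC; exact: subE.2.
  move=> Ex; have [d dx] := Es _ Ex; exists (d / c); split.
    by apply: subspaceB => //; exact: subspaceZ.
  exact: lspan_eliminate ec dx.
apply: (IH _ subE) => x Ex; have [c cx] := Es _ Ex.
have [c0|c0] := eqVneq c 0; first by move: cx; rewrite c0 scale0r subr0.
by exfalso; apply: nE; exists x; split=> //; exists c.
Qed.

(** The descending chain condition, by induction on the generators instead of a dimension count. The
    traces on the span of [s] stabilize; either every [E n] contains a pivot for [v], which reduces
    a vector to such a trace, or from some index on there is no part outside the span of [s]. *)
Lemma subspace_stabilize s (E : nat -> set V) :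
  (forall n, is_subspace (E n)) -> (forall n, E n.+1 `<=` E n) ->
  E 0%N `<=` lspan [set 0] s -> exists N, forall n, (N <= n)%N -> E N `<=` E n.
Proof.
move=> + decE.
have decE' (E' : nat -> set V) : (forall n, E' n.+1 `<=` E' n) ->
    forall m n, (m <= n)%N -> E' n `<=` E' m.
  move=> {}decE m n; elim: n => [|n IH]; first by rewrite leqn0 => /eqP ->.
  rewrite leq_eqVlt => /predU1P[->//|mn]; exact: (subset_trans (decE n) (IH mn)).
elim: s E decE => [|v s IH] E decE subE Es.
  exists 0%N => n _ x /Es ->; exact: (subE n).1.
have subs := lspan_subspace s subspace0.
have [n|n||N1 N1P] := IH (fun n => E n `&` lspan [set 0] s).
- exact: setSI.
- exact: subspaceI.
- exact: subIsetr.
pose P n := exists e, E n e /\ exists c, c != 0 /\ lspan [set 0] s (e - c *: v).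
have Pv n x : ~ P n -> E n x -> lspan [set 0] s x.
  move=> nP Ex; have [c cx] := Es _ (decE' _ decE _ _ (leq0n n) _ Ex).
  have [c0|c0] := eqVneq c 0; first by move: cx; rewrite c0 scale0r subr0.
  by exfalso; apply: nP; exists x; split=> //; exists c.
have [PT|/existsNP[N2 nP]] := pselect (forall n, P n).
  exists N1 => n N1n x Ex.
  have [e [Ee [c [c0 ec]]]] := PT n.
  have [d dx] := Es _ (decE' _ decE _ _ (leq0n N1) _ Ex).
  rewrite -[x](subrK ((d / c) *: e)); apply: subspaceD => //; last first.
    exact: subspaceZ.
  apply: (N1P n N1n _ _).1; split.
    apply: subspaceB => //; apply: subspaceZ => //.
    exact: (decE' _ decE _ _ N1n).
  exact: lspan_eliminate ec dx.
exists (maxn N1 N2) => n; rewrite geq_max => /andP[N1n N2n] x Ex.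
apply: (N1P n N1n _ _).1; split.
  exact: (decE' _ decE _ _ (leq_maxl N1 N2)).
by apply: (Pv N2) => //; exact: (decE' _ decE _ _ (leq_maxr N1 N2)).
Qed.

End Subspaces.

(* The rank-nullity theorem, for the mere finiteness of the dimension. *)
Lemma lspan_extension {R : realType} {V W : normedModType R[i]} (f : V -> W)
    (E : set V) (s : seq W) (t : seq V) :
  linear f -> is_subspace E -> f @` E `<=` lspan [set 0] s ->
  E `&` f @^-1` [set 0] `<=` lspan [set 0] t ->
  exists u, E `<=` lspan [set 0] u.
Proof.
move=> linf; elim: s E => [|w s IH] E subE Es Et.
  by exists t => x Ex; apply: Et; split=> //; apply: Es; exists x.
have subs : is_subspace (lspan [set 0] s) := lspan_subspace s subspace0.
have f0 : f 0 = 0 by have := linf (-1) 0 0; rewrite scaler0 addr0 scaleN1r addNr.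
have subf : is_subspace (E `&` f @^-1` lspan [set 0] s).
  apply: subspaceI => //; split=> [|a x y fx fy] /=; first by rewrite f0; exact: subs.1.
  by rewrite linf; exact: subs.2.
have [[e [Ee [c [c0 ec]]]]|nE] :=
    pselect (exists e, E e /\ exists c, c != 0 /\ lspan [set 0] s (f e - c *: w)).
  have [||u uE] := IH _ subf.
  - by move=> _ [x [Ex fx] <-].
  - by move=> x [[Ex _] fx]; exact: Et.
  exists (e :: u) => x Ex.
  have [|d dx] := Es (f x); first by exists x.
  exists (d / c); apply: uE; split.
    by apply: subspaceB => //; exact: subspaceZ.
  rewrite /= addrC -scaleNr linf scaleNr addrC.
  exact: lspan_eliminate ec dx.
apply: (IH _ subE _ Et) => _ [x Ex <-].
have [|c cx] := Es (f x); first by exists x.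
have [c0|c0] := eqVneq c 0; first by move: cx; rewrite c0 scale0r subr0.
by exfalso; apply: nE; exists x; split=> //; exists c.
Qed.

Lemma finite_dimensionalP {R : realType} (Y : normedModType R[i]) (E : set Y) :
  finite_dimensional E <-> exists s, E = lspan [set 0] s.
Proof.
have spanE n (v : 'I_n -> Y) :
    [set \sum_(i < n) c i *: v i | c in [set: 'I_n -> R[i]]] =
    lspan [set 0] [seq v i | i <- enum 'I_n].
  elim: n v => [|n IH] v.
    apply/seteqP; rewrite enum_ord0; split=> x /=.
      by move=> [c _ <-]; rewrite big_ord0.
    by move=> ->; exists (fun=> 0) => //; rewrite big_ord0.
  rewrite enum_ordSl /= -map_comp -(IH (v \o lift ord0)).
  apply/seteqP; split=> x /=.
    move=> [c _ <-]; exists (c ord0), (c \o lift ord0) => //.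
    by rewrite big_ord_recl addrAC subrr add0r.
  move=> [a [c _ cx]].
  exists (fun i => if unlift ord0 i is Some j then c j else a) => //.
  rewrite big_ord_recl unlift_none -[x in RHS](subrK (a *: v ord0)) -cx addrC.
  by congr (_ + _); apply: eq_bigr => i _; rewrite liftK.
split=> [[n [v ->]]|[s ->]]; first by exists [seq v i | i <- enum 'I_n].
exists (size s), (tnth (in_tuple s)).
rewrite spanE; congr lspan.
by rewrite -[LHS](map_tnth_enum (in_tuple s)).
Qed.

(** When [v] is outside [M] it has a positive distance [d] to [M], so the coefficient of [v] is a
    bounded functional, of norm at most [1 / d]. Approximants of [x] then have convergent
    coefficients, and only scalars pass to the limit. *)
Lemma closed_addline {R : realType} {V : normedModType R[i]} (M : set V) (v : V) :
  closed M -> is_subspace M -> closed [set x | exists c, M (x - c *: v)].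
Proof.
move=> /closed_rnormP clM subM; have [Mv|nMv] := pselect (M v).
  suff -> : [set x | exists c, M (x - c *: v)] = M by apply/closed_rnormP.
  apply/seteqP; split=> [x [c cx]|x Mx]; last first.
    by exists 0; rewrite scale0r subr0.
  by rewrite -(@subrK V (c *: v) x); apply: subspaceD => //; exact: subspaceZ.
have [d d0 dM] : exists2 d : R, 0 < d & forall m, M m -> d <= rnorm (v - m).
  apply: contrapT => nd; apply: nMv; apply: clM => e e0.
  apply: contrapT => ne; apply: nd; exists e => // m Mm.
  by rewrite leNgt; apply/negP => me; apply: ne; exists m.
have cd c y : M (y - c *: v) -> rnorm c * d <= rnorm y.
  move=> My; have [->|c0] := eqVneq c 0; first by rewrite rnorm0 mul0r rnorm_ge0.
  have := dM _ (subspaceN subM (subspaceZ subM c^-1 My)).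
  rewrite opprK scalerBr scalerA mulVf// scale1r addrC subrK rnormZ rnormV.
  by rewrite mulrC ler_pdivlMr ?rnorm_gt0 1?mulrC//; exact/eqP.
apply/closed_rnormP => x xM.
have h0 n : 0 < 2^-1 ^+ n :> R by rewrite exprn_gt0.
(* With tolerance [d / 4 * 2^-1 ^+ n], consecutive coefficients differ by at most 3/8 of
   [2^-1 ^+ n], within the half that [halving_lim] allows. *)
have /choice[yc ycP] n : exists yc : V * R[i],
    M (yc.1 - yc.2 *: v) /\ rnorm (x - yc.1) < d / 4 * 2^-1 ^+ n.
  have [|y [c Mc] xy] := xM (d / 4 * 2^-1 ^+ n); first by rewrite mulr_gt0//; lra.
  by exists (y, c).
have [|n|n|c cP] := @halving_lim _ _ (snd \o yc) (fun n => 2^-1 ^+ n)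
  seq_complete_scalars.
- by move=> n; exact: ltW.
- by rewrite exprS; lra.
- have [Mn xn] := ycP n; have [MS xS] := ycP n.+1.
  have /cd : M ((yc n.+1).1 - (yc n).1 - ((yc n.+1).2 - (yc n).2) *: v).
    have := subspaceB subM MS Mn; congr M.
    by rewrite scalerBl !opprB addrACA [RHS]addrACA [- _ + _]addrC.
  have := rnorm_tri x (yc n.+1).1 (yc n).1; rewrite (rnormC _ x) => tri cdn.
  rewrite -(ler_pM2r d0) (le_trans cdn)// (le_trans tri)//.
  by move: xn xS; rewrite exprS; have := h0 n; nra.
exists c; apply: clM => e e0.
have [n nP] := geometric_half_lt (d / 4 + rnorm v) e0.
have [Mn xn] := ycP n; exists ((yc n).1 - (yc n).2 *: v) => //.
have -> : x - c *: v - ((yc n).1 - (yc n).2 *: v) =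
          x - (yc n).1 + ((yc n).2 - c) *: v.
  by rewrite scalerBl opprB addrACA [RHS]addrACA [- _ + _]addrC.
have := rnormD (x - (yc n).1) (((yc n).2 - c) *: v); rewrite rnormZ => tri.
have := cP n; rewrite /= => cn; have := rnorm_ge0 v; nra.
Qed.

Lemma closed_lspan {R : realType} {V : normedModType R[i]} (M : set V) (s : seq V) :
  closed M -> is_subspace M -> closed (lspan M s).
Proof.
move=> clM subM; elim: s => // v s IH.
exact: closed_addline IH (lspan_subspace s subM).
Qed.

(** * The open mapping theorem *)

Section OpenMapping.
Context {R : realType}.

Lemma rnorm_bop (X Y : normedModType R[i]) (T : bop X Y) x :
  rnorm (T x) <= opnorm T * rnorm x.
Proof. by rewrite -lecR rmorphM /= -!rnormE ler_opnorm. Qed.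

Lemma subspace_image (X Y : normedModType R[i]) (T : bop X Y) (M : set X) :
  is_subspace M -> is_subspace (T @` M).
Proof.
move=> subM; split=> [|a _ _ [x Mx <-] [y My <-]].
  by exists 0; [exact: subM.1|rewrite linear0].
by exists (a *: x + y); [exact: subM.2|rewrite linearP].
Qed.

Section Image.
Context {X Y : completeNormedModType R[i]} (T : bop X Y) (M : set X).
Hypotheses (clM : closed M) (subM : is_subspace M) (clN : closed (T @` M)).

(** Membership of [z] in the closure of the image of the ball of radius [n] of [M]. *)
Let approx (n : R) (z : Y) : Prop := forall e : R, 0 < e ->
  exists2 m, M m & rnorm m <= n /\ rnorm (z - T m) < e.

(* The Baire category theorem in [T @` M], by the usual nested balls. *)
Lemma image_nonmeager : exists (n : R) (z0 : Y) (r : R),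
  [/\ 0 < r, (T @` M) z0 &
    forall z, (T @` M) z -> rnorm (z - z0) < r -> approx n z].
Proof.
apply: contrapT => meager.
(* [F] shrinks a ball of centre [z] and radius [r] away from the image of the ball of radius [n].
   The factor 2 keeps the limit [l] of the centres off that image, since [l] is within one radius of
   each centre. *)
have /choice[F FP] (p : nat * (Y * R)) : exists q : Y * R,
    (T @` M) p.2.1 -> 0 < p.2.2 ->
    [/\ (T @` M) q.1, rnorm (q.1 - p.2.1) <= p.2.2 / 2,
        0 < q.2, q.2 <= p.2.2 / 2 &
        forall m, M m -> rnorm m <= p.1%:R -> 2 * q.2 <= rnorm (q.1 - T m)].
  case: p => n [z r] /=; have [Nz|?] := pselect ((T @` M) z); last by exists (0, 0).
  have [r0|?] := pselect (0 < r); last by exists (0, 0).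
  have [z' [Nz' zz' nz']] : exists z', [/\ (T @` M) z', rnorm (z' - z) < r / 2 &
      ~ approx n%:R z'].
    apply: contrapT => nz; apply: meager; exists n%:R, z, (r / 2).
    split=> // [|z' Nz' zz']; first lra.
    by apply: contrapT => nz'; apply: nz; exists z'.
  have [e [e0 eP]] : exists e, 0 < e /\
      forall m, M m -> rnorm m <= n%:R -> e <= rnorm (z' - T m).
    apply: contrapT => ne; apply: nz' => e e0.
    apply: contrapT => nm; apply: ne; exists e; split=> // m Mm mn.
    by rewrite leNgt; apply/negP => me; apply: nm; exists m.
  exists (z', Num.min (e / 2) (r / 2)) => _ _; split=> //=; first exact: ltW.
  - by rewrite lt_min; apply/andP; split; lra.
  - by rewrite ge_min lexx orbT.
  - move=> m Mm mn; apply: le_trans (eP m Mm mn).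
    have : Num.min (e / 2) (r / 2) <= e / 2 by rewrite ge_min lexx.
    lra.
pose s := fix s n : Y * R := if n is k.+1 then F (k, s k) else (0, 1).
have sP n : (T @` M) (s n).1 /\ 0 < (s n).2.
  elim: n => [|n [Ns s0]]; last by have [] := FP (n, s n) Ns s0.
  by split; [exact: (subspace_image T subM).1|exact: ltr01].
have FsP n := FP (n, s n) (sP n).1 (sP n).2.
have [|n|n|n|l lP] := @halving_lim _ _ (fst \o s) (snd \o s).
- exact: seq_complete_normed.
- exact/ltW/(sP n).2.
- by have [] := FsP n.
- by have [] := FsP n.
have s2 n : (s n).2 <= 1 * 2^-1 ^+ n.
  elim: n => [|n IH]; first by rewrite expr0 mul1r.
  by have [_ _ _ /le_trans -> //] := FsP n; move: IH; rewrite exprS /=; lra.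
have [m Mm ml] : (T @` M) l.
  move/closed_rnormP: clN; apply=> e e0.
  have [n nP] := geometric_half_lt 1 e0.
  exists (s n).1; first exact: (sP n).1.
  by rewrite rnormC (le_lt_trans (lP n))// (le_lt_trans (s2 n)).
pose n := (Num.truncn (rnorm m)).+1.
have [_ _ s0 _ /(_ m Mm)] := FsP n; rewrite ml => /(_ (ltW (truncnS_gt _))) sl.
by have := lP n.+1; rewrite /= in s0 sl *; lra.
Qed.

(** Scaling by [c] brings [z] to norm [r / 2], so [z0 + c z] and [z0] are both approximable from the
    ball of radius [n]; the difference of the approximants, divided by [c], serves for [z]. Its norm
    is at most [2 * n / c], whence [K = 4 * n / r], and two errors of a quarter add up to a half. *)
Lemma image_half : exists2 K : R, 0 <= K & forall z, (T @` M) z ->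
  exists m, [/\ M m, rnorm m <= K * rnorm z & rnorm (z - T m) <= rnorm z / 2].
Proof.
have [n [z0 [r [r0 Nz0 z0P]]]] := image_nonmeager.
have n0 : 0 <= n.
  have [|m _ [mn _]] := z0P _ Nz0 _ 1 ltr01; first by rewrite subrr rnorm0.
  exact: le_trans (rnorm_ge0 m) mn.
exists (4 * n / r) => [|z Nz]; first by rewrite divr_ge0 ?mulr_ge0// ltW.
have [->|/eqP z1] := eqVneq z 0.
  exists 0; split; first exact: subM.1.
    by rewrite !rnorm0 mulr0.
  by rewrite linear0 subrr rnorm0 mul0r.
have zp := rnorm_gt0 z1.
pose c : R := r / 2 / rnorm z.
have c0 : 0 < c by rewrite !divr_gt0.
have rc x : rnorm (c%:C *: x : Y) = c * rnorm x.
  by rewrite rnormZ rnorm_real gtr0_norm.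
have subN := subspace_image T subM.
have e0 : 0 < c * (rnorm z / 4) by rewrite mulr_gt0 ?divr_gt0.
have [||m1 Mm1 [m1n m1e]] := z0P (z0 + c%:C *: z) _ _ _ e0.
- by apply: subspaceD => //; exact: subspaceZ.
- by rewrite addrC addKr rc /c divfK ?gt_eqF//; lra.
have [|m2 Mm2 [m2n m2e]] := z0P z0 Nz0 _ _ e0; first by rewrite subrr rnorm0.
have cN0 : c%:C != 0 by rewrite fmorph_eq0 gt_eqF.
exists (c%:C^-1 *: (m1 - m2)); split.
- by apply: subspaceZ => //; exact: subspaceB.
- rewrite rnormZ rnormV rnorm_real gtr0_norm// ler_pdivrMl//.
  have -> : c * (4 * n / r * rnorm z) = 2 * n.
    by rewrite /c; field; rewrite !gt_eqF.
  by have := rnormB m1 m2; lra.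
rewrite -(ler_pM2l c0) -rc scalerBr -linearZ scalerA divff// scale1r.
have -> : c%:C *: z - T (m1 - m2) = (z0 + c%:C *: z - T m1) - (z0 - T m2).
  by rewrite linearB !opprB -[z0 + _ - _]addrA [RHS]addrC addrA subrK addrCA.
have := rnormB (z0 + c%:C *: z - T m1) (z0 - T m2); lra.
Qed.

(** Successive approximation: each correction halves the residual [z - T (x n)], so the corrections
    are bounded by [K * rnorm z * 2^-1 ^+ n] and sum to at most [2 * K * rnorm z]. *)
Lemma open_mapping : exists2 K : R, 0 <= K & forall z, (T @` M) z ->
  exists x, [/\ M x, T x = z & rnorm x <= K * rnorm z].
Proof.
have [K K0 halfP] := image_half.
have /choice[F FP] z : exists m, (T @` M) z ->
    [/\ M m, rnorm m <= K * rnorm z & rnorm (z - T m) <= rnorm z / 2].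
  have [/halfP[m mP]|?] := pselect ((T @` M) z); first by exists m.
  by exists 0.
have subN := subspace_image T subM.
exists (2 * K) => [|z Nz]; first by rewrite mulr_ge0.
pose x := fix x n := if n is k.+1 then x k + F (z - T (x k)) else 0.
have xS n : x n.+1 = x n + F (z - T (x n)) by [].
have Mx n : M (x n).
  elim: n => [|n IH]; first exact: subM.1.
  have [|Mn _ _] := FP (z - T (x n)); first by apply: subspaceB => //; exists (x n).
  exact: subspaceD.
have FxP n : [/\ M (F (z - T (x n))), rnorm (F (z - T (x n))) <= K * rnorm (z - T (x n)) &
    rnorm (z - T (x n) - T (F (z - T (x n)))) <= rnorm (z - T (x n)) / 2].
  by apply: FP; apply: subspaceB => //; exists (x n).
have zx n : rnorm (z - T (x n)) <= rnorm z * 2^-1 ^+ n.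
  elim: n => [|n IH]; first by rewrite linear0 subr0 expr0 mulr1.
  have [_ _] := FxP n; rewrite -addrA -opprD -linearD -xS => /le_trans -> //.
  by rewrite exprSr; lra.
have h0 n : 0 <= 2^-1 ^+ n :> R by rewrite exprn_ge0.
have z0 := rnorm_ge0 z.
have [|n|n|n|l lP] := @halving_lim _ _ x (fun n => 2 * K * rnorm z * 2^-1 ^+ n).
- exact: seq_complete_normed.
- by rewrite !mulr_ge0.
- by rewrite exprSr mulrA.
- rewrite xS addrAC subrr add0r; have [_ /le_trans le _] := FxP n; apply: le.
  by have := ler_wpM2l K0 (zx n); lra.
exists l; split.
- move/closed_rnormP: clM; apply=> e e0.
  have [n nP] := geometric_half_lt (2 * K * rnorm z) e0.
  by exists (x n) => //; rewrite rnormC (le_lt_trans (lP n)).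
- apply/eqP; rewrite -subr_eq0; apply/eqP/rnorm_eq0/eqP.
  rewrite eq_le rnorm_ge0 andbT; apply/ler_addgt0Pr => e e0; rewrite add0r.
  have [n nP] := geometric_half_lt (opnorm T * (2 * K * rnorm z) + rnorm z) e0.
  have := rnorm_tri (T (x n)) (T l) z; rewrite -linearB (rnormC (T (x n)) z) => tri.
  have := rnorm_bop T (l - x n); rewrite (rnormC l) => Tl.
  have := ler_wpM2l (opnorm_ge0 T) (lP n); have := zx n; lra.
- by have := lP 0%N; rewrite /= sub0r rnormN expr0 mulr1.
Qed.

End Image.
End OpenMapping.

(** * Power series *)

Section PowerSeries.
Context {R : realType} {X : completeNormedModType R[i]}.
Implicit Types (a : nat -> X) (w z : R[i]) (C q : R).

(** The radius of convergence is at least [1 / q]; sums are taken only for [rnorm w * q <= 2^-1],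
    where the terms are bounded by [C * 2^-1 ^+ n] uniformly in [w]. *)
Definition geo C q a : Prop := forall n, rnorm (a n) <= C * q ^+ n.

(* The sum of the series [w ^ i a_i], provided it converges at the rate
   [2 ^- n], and [0] otherwise. *)
Definition psum a w : X :=
  xget 0 [set l | exists C, forall n,
    rnorm (\sum_(i < n) w ^+ i *: a i - l) <= C * 2^-1 ^+ n].

Lemma half_le0 (r C : R) : (forall n, r <= C * 2^-1 ^+ n) -> r <= 0.
Proof.
move=> rC; rewrite leNgt; apply/negP => r0.
by have [n] := geometric_half_lt C r0; rewrite ltNge rC.
Qed.

Lemma psum_unique a w l C :
  (forall n, rnorm (\sum_(i < n) w ^+ i *: a i - l) <= C * 2^-1 ^+ n) ->
  psum a w = l.
Proof.
move=> lP; rewrite /psum; case: xgetP => [y _ [D yP]|/(_ l)]; last first.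
  by case; exists C.
apply/eqP; rewrite -subr_eq0; apply/eqP/rnorm_eq0/eqP.
rewrite eq_le rnorm_ge0 andbT; apply: (@half_le0 _ (C + D)) => n.
have := rnorm_tri (\sum_(i < n) w ^+ i *: a i) y l.
have := lP n; have := yP n; rewrite (rnormC _ y); lra.
Qed.

Section Geometric.
Variables (q : R) (w : R[i]).
Hypotheses (q0 : 0 <= q) (wq : rnorm w * q <= 2^-1).

Lemma geo_ge0 C a : geo C q a -> 0 <= C.
Proof. by move=> /(_ 0%N); rewrite expr0 mulr1; apply: le_trans; exact: rnorm_ge0. Qed.

Lemma geo_shift C a : geo C q a -> geo (C * q) q (fun n => a n.+1).
Proof. by move=> aP n; rewrite -mulrA -exprS; exact: aP. Qed.

Lemma geo_shiftn k C a : geo C q a -> geo (C * q ^+ k) q (fun n => a (n + k)%N).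
Proof. by move=> aP n; rewrite -mulrA -exprD addnC; exact: aP. Qed.

Lemma geo_term C a n : geo C q a -> rnorm (w ^+ n *: a n) <= C * 2^-1 ^+ n.
Proof.
move=> aP; rewrite rnormZ rnormX.
apply: le_trans (ler_wpM2l _ (aP n)) _; first by rewrite exprn_ge0// rnorm_ge0.
rewrite mulrCA -exprMn ler_wpM2l// ?(geo_ge0 aP)// lerXn2r// nnegrE ?invr_ge0//.
by rewrite mulr_ge0// rnorm_ge0.
Qed.

Lemma psumP C a n : geo C q a ->
  rnorm (\sum_(i < n) w ^+ i *: a i - psum a w) <= 2 * C * 2^-1 ^+ n.
Proof.
move=> aP; have C0 := geo_ge0 aP.
have [|k|k|k|l lP] := @halving_lim _ _ (fun n => \sum_(i < n) w ^+ i *: a i)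
    (fun n => 2 * C * 2^-1 ^+ n).
- exact: seq_complete_normed.
- by rewrite !mulr_ge0// exprn_ge0.
- by rewrite exprSr mulrA.
- rewrite big_ord_recr/= addrAC subrr add0r (le_trans (geo_term k aP))//.
  by rewrite mulrAC; lra.
by rewrite (psum_unique lP).
Qed.

Lemma psum_le C a : geo C q a -> rnorm (psum a w) <= 2 * C.
Proof. by move=> /(psumP 0); rewrite big_ord0 sub0r rnormN expr0 mulr1. Qed.

Lemma psum_shift C a : geo C q a ->
  psum a w = a 0%N + w *: psum (fun n => a n.+1) w.
Proof.
move=> aP; have C0 := geo_ge0 aP; have sP := geo_shift aP.
have wC : rnorm w * (2 * (C * q)) <= C.
  by have := ler_wpM2l C0 wq; lra.
have w0 := rnorm_ge0 w.
apply: (@psum_unique _ _ _ (2 * C)) => -[|n].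
  rewrite big_ord0 sub0r rnormN expr0 mulr1 (le_trans (rnormD _ _))// rnormZ.
  have := aP 0%N; rewrite expr0 mulr1; have := ler_wpM2l w0 (psum_le sP); lra.
rewrite big_ord_recl expr0 scale1r opprD addrACA subrr add0r.
under eq_bigr => i _ do rewrite lift0 exprS -scalerA.
rewrite -scaler_sumr -scalerBr rnormZ.
apply: le_trans (ler_wpM2l w0 (psumP n sP)) _.
rewrite mulrA exprS; have : 0 <= 2^-1 ^+ n :> R by rewrite exprn_ge0.
move=> h0; have := ler_wpM2r h0 wC; lra.
Qed.

End Geometric.

Lemma psum0 q C a : 0 <= q -> geo C q a -> psum a 0 = a 0%N.
Proof.
by move=> q0 /psum_shift -> //; rewrite ?scale0r ?addr0// rnorm0 mul0r invr_ge0.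
Qed.

(** The coefficients, as a power series in [w], of the divided difference of [psum a] between [w]
    and [z]: expand each [(w ^+ n - z ^+ n) / (w - z)] as the sum of the [w ^+ i * z ^+ (n - 1 - i)]
    and collect the powers of [w]. *)
Definition dcoef a z (i : nat) : X := psum (fun n => a (n + i).+1) z.

Lemma geo_dcoef C q a z : 0 <= q -> rnorm z * q <= 2^-1 -> geo C q a ->
  geo (2 * C * q) q (dcoef a z).
Proof.
move=> q0 zq aP i.
have := psum_le q0 zq (geo_shiftn i (geo_shift aP)); rewrite /dcoef.
by rewrite !mulrA.
Qed.

(* Both sides are multiplied by [w] when the sequence is shifted, so that their
   difference is [O(2 ^- n)] for all [n]. *)
Lemma psum_diff C q a w z : 0 <= q -> rnorm w * q <= 2^-1 ->
    rnorm z * q <= 2^-1 -> geo C q a ->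
  psum a w - psum a z = (w - z) *: psum (dcoef a z) w.
Proof.
move=> q0 wq zq aP.
pose D b := psum b w - psum b z - (w - z) *: psum (dcoef b z) w.
have DS B b : geo B q b -> D b = w *: D (fun n => b n.+1).
  move=> bP; rewrite /D (psum_shift q0 wq bP) (psum_shift q0 zq bP).
  rewrite (psum_shift q0 wq (geo_dcoef q0 zq bP)).
  have -> : dcoef b z 0 = psum (fun n => b n.+1) z.
    by rewrite /dcoef; congr psum; apply/funext => n; rewrite addn0.
  have -> : (fun n => dcoef b z n.+1) = dcoef (fun n => b n.+1) z.
    by apply/funext => i; congr psum; apply/funext => n; rewrite addnS.
  rewrite opprD addrACA subrr add0r scalerDr scalerBl opprD addrA opprB subrKA.
  by rewrite !scalerBr !scalerA [(w - z) * w]mulrC.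
(* The two sums contribute [2 * B] each, and the last term [4 * B] because
   [rnorm (w - z) * q <= 1]. *)
have D8 B b : geo B q b -> rnorm (D b) <= 8 * B.
  move=> bP.
  have := psum_le q0 wq bP; have := psum_le q0 zq bP.
  have := psum_le q0 wq (geo_dcoef q0 zq bP).
  have wz0 := rnorm_ge0 (w - z); move=> /(ler_wpM2l wz0); rewrite -rnormZ.
  have wzq : rnorm (w - z) * q <= 1.
    by have := ler_wpM2r q0 (rnormB w z); lra.
  have := ler_wpM2r (geo_ge0 bP) wzq.
  have := rnormB (psum b w - psum b z) ((w - z) *: psum (dcoef b z) w).
  have := rnormB (psum b w) (psum b z).
  rewrite /D; lra.
apply/eqP; rewrite -subr_eq0; apply/eqP/rnorm_eq0/eqP.
rewrite eq_le rnorm_ge0 andbT; apply: (@half_le0 _ (8 * C)) => n.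
elim: n a C aP => [|n IH] a C aP; first by rewrite expr0 mulr1; exact: D8.
have := DS _ _ aP; rewrite {1}/D => ->; rewrite rnormZ.
apply: le_trans (ler_wpM2l (rnorm_ge0 w) (IH _ _ (geo_shift aP))) _.
have h0 : 0 <= 2^-1 ^+ n :> R by rewrite exprn_ge0.
have := ler_wpM2r (mulr_ge0 (geo_ge0 aP) h0) wq.
rewrite exprS; lra.
Qed.

(** By [psum_diff] the difference quotient is [psum (dcoef a z) (h + z)]. A second use of
    [psum_diff], on [dcoef a z], makes it Lipschitz in [h]; the final 1 in [L] only ensures
    positivity. The strict bound on [z] leaves room [d] for [h]. *)
Lemma psum_derivable C q a z : 0 < q -> rnorm z * q < 2^-1 -> geo C q a ->
  derivable (psum a : R[i]^o -> X) z 1.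
Proof.
move=> q0 zq aP; have q1 := ltW q0; have zq' := ltW zq.
apply/cvg_ex; exists (psum (dcoef a z) z); apply/cvgrPdist_lt => _ /gt0_realC[e e0 ->].
pose d := 2^-1 / q - rnorm z.
have d0 : 0 < d by rewrite subr_gt0 ltr_pdivlMr.
pose L := 2 * (2 * (2 * C * q) * q) + 1.
have L0 : 0 < L.
  rewrite ltr_wpDl// !mulr_ge0 ?(geo_ge0 aP)//.
apply/nbhs_rnormP; exists (Num.min d (e / L)); first by rewrite lt_min d0 divr_gt0.
move=> h; rewrite sub0r rnormN lt_min => /andP[hd he] h0.
have wq : rnorm (h + z) * q <= 2^-1.
  rewrite -ler_pdivlMr// (le_trans (rnormD _ _))//; move: hd; rewrite /d; lra.
rewrite rnormE ltcR /= [h *: 1]mulr1.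
have -> : psum a (h + z) - psum a z = h *: psum (dcoef a z) (h + z).
  by rewrite (psum_diff q1 wq zq' aP) addrK.
rewrite scalerA mulVf// scale1r rnormC.
have bP := geo_dcoef q1 zq' aP.
rewrite (psum_diff q1 wq zq' bP) addrK rnormZ.
have cP := geo_dcoef q1 zq' bP.
have := psum_le q1 wq cP; move=> /(ler_wpM2l (rnorm_ge0 h)).
have : rnorm h * L < e by rewrite -ltr_pdivlMr.
have := rnorm_ge0 h; rewrite /L; lra.
Qed.

Lemma psum_bop (T : bop X X) C q a w : 0 <= q -> rnorm w * q <= 2^-1 ->
  geo C q a -> T (psum a w) = psum (T \o a) w.
Proof.
move=> q0 wq aP; apply/esym/(@psum_unique _ _ _ (opnorm T * (2 * C))) => n.
have -> : \sum_(i < n) w ^+ i *: (T \o a) i = T (\sum_(i < n) w ^+ i *: a i).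
  by rewrite linear_sum; apply: eq_bigr => i _; rewrite linearZ.
rewrite -linearB -mulrA (le_trans (rnorm_bop _ _))// ler_wpM2l ?opnorm_ge0//.
exact: (psumP q0 wq n aP).
Qed.

(** [T \o a] is the sequence [a] delayed by one with a leading 0, and a delay multiplies the sum by
    [w]. *)
Lemma psum_eigenvector (T : bop X X) C q a w : 0 <= q ->
    rnorm w * q <= 2^-1 -> geo C q a ->
    T (a 0%N) = 0 -> (forall n, T (a n.+1) = a n) ->
  T (psum a w) = w *: psum a w.
Proof.
move=> q0 wq aP T0 TS.
have TaP : geo (opnorm T * C) q (T \o a).
  move=> n; rewrite -mulrA (le_trans (rnorm_bop _ _))// ler_wpM2l ?opnorm_ge0//.
rewrite (psum_bop T q0 wq aP) (psum_shift q0 wq TaP) /= T0 add0r.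
by congr (_ *: psum _ _); apply/funext.
Qed.

End PowerSeries.

(** * Upper semi-Fredholm operators *)

Section Operators.
Context {R : realType}.

Definition upper_semi_fredholm (X : normedModType R[i]) (T : bop X X) : Prop :=
  closed (range T) /\ finite_dimensional [set x | T x = 0].

Definition finite_ascent (X : normedModType R[i]) (T : bop X X) : Prop :=
  exists n, ker_pow T n = ker_pow T n.+1.

Lemma sigma_abP (X : normedModType R[i]) (T : bop X X) l :
  ~ sigma_ab T l <->
  upper_semi_fredholm (sub_scalar T l) /\ finite_ascent (sub_scalar T l).
Proof.
have finP : ascent (sub_scalar T l) <> None <-> finite_ascent (sub_scalar T l).
  by rewrite ascent_None -existsNP; split=> -[n]; [move/contrapT|]; exists n.
rewrite -finP /sigma_ab /= not_orP; split=> -[Phi asc]; split=> //.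
exact: contrapT.
Qed.

Lemma finite_ascentP (X : normedModType R[i]) (T : bop X X) p :
  ker_pow T p = ker_pow T p.+1 ->
  forall k x, iter (k + p) T x = 0 -> iter p T x = 0.
Proof.
move=> Tp; elim=> [|k IH] x //; rewrite addSn iterSr => /IH.
rewrite -iterSr => h; have : ker_pow T p.+1 x by [].
by rewrite -Tp.
Qed.

Lemma finite_ascent_intro (X : normedModType R[i]) (T : bop X X) p :
  (forall x, iter p.+1 T x = 0 -> iter p T x = 0) -> finite_ascent T.
Proof.
move=> Tp; exists p; apply/seteqP; split=> x; last exact: Tp.
by rewrite /ker_pow /= => ->; rewrite linear0.
Qed.

Lemma kernel_subspace (X Y : normedModType R[i]) (T : bop X Y) :
  is_subspace [set x | T x = 0].
Proof.
split=> [|a x y /= Tx Ty]; first by rewrite /= linear0.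
by rewrite /= linearP /= Tx Ty scaler0 addr0.
Qed.

(** * Ascent and semi-Fredholm properties of upper triangular operators *)

Section UpperTriangular.
Context {X : normedModType R[i]}.
Implicit Types A B C : bop X X.

Lemma sub_scalar_upper_triangular A C B l :
  sub_scalar (upper_triangular A C B) l =
  upper_triangular (sub_scalar A l) C (sub_scalar B l).
Proof.
apply: bopE => -[x y]; rewrite sub_scalarE.
have -> : upper_triangular A C B (x, y) - l *: (x, y) =
  (A x + C y - l *: x, B y - l *: y) by [].
by rewrite addrAC.
Qed.

Lemma iter_upper_triangular_snd A C B n u :
  (iter n (upper_triangular A C B) u).2 = iter n B u.2.
Proof. by elim: n => // n IH; rewrite /= IH. Qed.

Lemma iter_upper_triangular_inl A C B n x :
  iter n (upper_triangular A C B) (x, 0) = (iter n A x, 0).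
Proof. by elim: n => // n IH; rewrite /= IH /= !linear0 addr0. Qed.

Lemma iter_upper_triangular_inr A B n y :
  iter n (upper_triangular A 0 B) (0, y) = (0, iter n B y).
Proof. by elim: n => // n IH; rewrite /= IH /= linear0 addr0. Qed.

(** If the power [p + q + 1] kills [u], the ascent of [B] shows that the power [q] already kills the
    second coordinate. What remains lies in the first summand, where the operator acts as [A]. *)
Lemma finite_ascent_upper_triangular A C B :
  finite_ascent A -> finite_ascent B -> finite_ascent (upper_triangular A C B).
Proof.
move=> [p Ap] [q Bq]; apply: (@finite_ascent_intro _ _ (p + q)) => u.
rewrite -addSn !iterD; set v := iter q _ u => Mv.
have v2 : v.2 = 0.
  rewrite /v iter_upper_triangular_snd; apply: (finite_ascentP Bq (k := p.+1)).
  rewrite iterD -(iter_upper_triangular_snd A C B q).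
  by rewrite -(iter_upper_triangular_snd A C B) Mv.
move: Mv; rewrite [v]surjective_pairing v2 !iter_upper_triangular_inl => -[Av].
by rewrite (finite_ascentP Ap (k := 1) Av).
Qed.

Lemma finite_ascent_upper_triangularl A C B :
  finite_ascent (upper_triangular A C B) -> finite_ascent A.
Proof.
move=> [n Mn]; apply: (@finite_ascent_intro _ _ n) => x Ax.
have := @finite_ascentP _ _ n Mn 1 (x, 0).
by rewrite !iter_upper_triangular_inl Ax => /(_ erefl) [].
Qed.

Lemma finite_ascent_upper_triangularr A B :
  finite_ascent (upper_triangular A 0 B) -> finite_ascent B.
Proof.
move=> [n Mn]; apply: (@finite_ascent_intro _ _ n) => x Bx.
have := @finite_ascentP _ _ n Mn 1 (0, x).
by rewrite !iter_upper_triangular_inr Bx => /(_ erefl) [].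
Qed.

Lemma findim_injective (Y Z : normedModType R[i]) (f : Y -> Z) E (F : set Z) :
  linear f -> injective f -> is_subspace E -> f @` E `<=` F ->
  finite_dimensional F -> finite_dimensional E.
Proof.
move=> linf injf subE EF /finite_dimensionalP[s Fs].
have f0 : f 0 = 0 by have := linf (-1) 0 0; rewrite scaler0 addr0 scaleN1r addNr.
have [||u Eu] := @lspan_extension _ _ _ f E s [::] linf subE.
- by rewrite -Fs.
- by move=> x [Ex /= fx]; apply: injf; rewrite fx.
by apply/finite_dimensionalP; exact: subspace_lspan subE Eu.
Qed.

Lemma rnorm_pair (x y : X) :
  [/\ rnorm x <= rnorm (x, y), rnorm y <= rnorm (x, y) &
      rnorm (x, y) <= rnorm x + rnorm y].
Proof.
rewrite -!lecR rmorphD /= -!rnormE prod_normE /=.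
rewrite !comparable_le_max ?real_comparable// !lexx orbT; split=> //.
by rewrite comparable_ge_max ?real_comparable// lerDl lerDr !normr_ge0.
Qed.

Lemma upper_semi_fredholm_direct_sum A B :
  upper_semi_fredholm (upper_triangular A 0 B) ->
  upper_semi_fredholm A /\ upper_semi_fredholm B.
Proof.
move=> [/closed_rnormP clM finM]; split; split.
- apply/closed_rnormP => u uA.
  have [|[x y] _ [<- _]] := clM (u, 0); last by exists x => //; rewrite addr0.
  move=> e /uA[_ [x _ <-] xe].
  exists (upper_triangular A 0 B (x, 0)); first by exists (x, 0).
  have -> : (u, 0) - upper_triangular A 0 B (x, 0) = (u - A x, 0).
    by congr pair; rewrite /= ?linear0 ?addr0 ?subrr.
  by have [_ _] := rnorm_pair (u - A x) 0; rewrite rnorm0 addr0; move/le_lt_trans->.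
- apply: (@findim_injective _ _ (fun x => (x, 0))) (kernel_subspace A) _ finM.
  + by move=> a x y; congr pair; rewrite /= scaler0 addr0.
  + by move=> x y [].
  + by move=> _ [x /= Ax <-]; rewrite /= Ax !linear0 addr0.
- apply/closed_rnormP => v vB.
  have [|[x y] _ [_ <-]] := clM (0, v); last by exists y.
  move=> e /vB[_ [y _ <-] ye].
  exists (upper_triangular A 0 B (0, y)); first by exists (0, y).
  have -> : (0, v) - upper_triangular A 0 B (0, y) = (0, v - B y).
    by congr pair; rewrite /= linear0 addr0 subrr.
  by have [_ _] := rnorm_pair 0 (v - B y); rewrite rnorm0 add0r; move/le_lt_trans->.
- apply: (@findim_injective _ _ (fun y => (0, y))) (kernel_subspace B) _ finM.
  + by move=> a x y; congr pair; rewrite /= scaler0 addr0.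
  + by move=> x y [].
  + by move=> _ [y /= By <-]; rewrite /= By linear0 addr0.
Qed.

End UpperTriangular.

Lemma lspan_image (X Y : normedModType R[i]) (T : bop X Y) s :
  lspan [set 0] (map T s) = T @` lspan [set 0] s.
Proof.
elim: s => [|v s IH] /=.
  by apply/seteqP; split=> [_ ->|_ [x -> <-]] /=; [exists 0|]; rewrite ?linear0.
rewrite IH; apply/seteqP; split=> [y [c [x sx xy]]|_ [x [c cx] <-]] /=.
  by exists (x + c *: v); [exists c; rewrite addrK|rewrite linearD linearZ /= xy subrK].
by exists c, (x - c *: v) => //; rewrite linearB linearZ.
Qed.

Lemma upper_semi_fredholm_upper_triangular (X : completeNormedModType R[i])
    (A B C : bop X X) :
  upper_semi_fredholm A -> upper_semi_fredholm B ->
  upper_semi_fredholm (upper_triangular A C B).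
Proof.
move=> [clA /finite_dimensionalP[s kerA]] [clB /finite_dimensionalP[t kerB]].
have [K K0 KP] := open_mapping closedT subspaceT clB.
(* This is [range A + C (ker B)]: [(u, B y)] is in the range exactly when [u - C y] is in [N], as
   [y] is determined up to [ker B]. *)
pose N := lspan (range A) (map C t).
have clN : closed N by apply: closed_lspan => //; exact: subspace_image subspaceT.
split.
  apply/closed_rnormP => -[u v] uvM.
  have [y _ yv] : range B v.
    move/closed_rnormP: clB; apply=> e /uvM[_ [[x y] _ <-] xye].
    exists (B y); first by exists y.
    by have [_ /le_lt_trans -> //] := rnorm_pair (u - (A x + C y)) (v - B y).
  have /lspanP[z] : N (u - C y).
    move/closed_rnormP: clN; apply=> e e0.
    (* Replacing [y'] by [y' + k'], an exact preimage of [v], costs [opnorm C * K] times the error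
       in the second coordinate; the 1 stands for the error in the first. *)
    pose L := 1 + opnorm C * K.
    have CK : 0 <= opnorm C * K by rewrite mulr_ge0 ?opnorm_ge0.
    have L0 : 0 < L by rewrite ltr_pwDl.
    have [|_ [[x' y'] _ <-] xye] := uvM (e / L); first by rewrite divr_gt0.
    set r := rnorm _ in xye.
    have [xy1 xy2] : rnorm (u - (A x' + C y')) <= r /\ rnorm (v - B y') <= r.
      by have [] := rnorm_pair (u - (A x' + C y')) (v - B y').
    have [|k' [_ Bk' k'K]] := KP (v - B y').
      by rewrite -yv -linearB; exists (y - y').
    have tk : lspan [set 0] t (y - y' - k').
      by rewrite -kerB /= !linearB /= Bk' yv subrr.
    exists (A x' - C (y - y' - k')).
      apply/lspanP; exists (- C (y - y' - k')).
        apply: subspaceN; first exact: lspan_subspace subspace0.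
        by rewrite lspan_image; exists (y - y' - k').
      by rewrite opprK subrK; exists x'.
    have -> : u - C y - (A x' - C (y - y' - k')) = u - (A x' + C y') - C k'.
      rewrite opprB !linearB /=.
      by rewrite !addrA subrK opprD addrA addrAC [u - _ - A x']addrAC.
    have := rnormB (u - (A x' + C y')) (C k').
    have := rnorm_bop C k'.
    have := ler_wpM2l (opnorm_ge0 C) k'K.
    have eL : r * L < e by rewrite -ltr_pdivlMr.
    have := ler_wpM2l CK xy2; move: xy1 eL; rewrite /L; lra.
  rewrite lspan_image => -[k tk <-] [x _ xu].
  exists (x, y + k) => //; congr pair.
    by rewrite /= xu linearD -[u - _ - _]addrA -opprD subrK.
  by move: tk; rewrite -kerB /= => tk; rewrite /= linearD /= yv tk addr0.
pose M := upper_triangular A C B; pose E := [set w | M w = 0].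
have subE : is_subspace E := kernel_subspace M.
have lin1 : linear (@fst X X) by [].
have lin2 : linear (@snd X X) by [].
(* Rank-nullity is used twice: the second projection sends the kernel into [ker B], and its fibre
   over 0 is sent injectively into [ker A] by the first projection. *)
have [|||r Er] := @lspan_extension _ _ _ (@fst X X) (E `&` snd @^-1` [set 0]) s [::] lin1.
- apply: subspaceI => //; split=> [//|a x y x0 y0].
  by rewrite /= x0 y0 scaler0 addr0.
- move=> _ [[x y] /= [Mxy y0] <-]; rewrite -kerA /=.
  by move: Mxy; rewrite /= y0 => -[]; rewrite linear0 addr0.
- by move=> [x y] /= [[_ ->] ->].
have [||w Ew] := @lspan_extension _ _ _ (@snd X X) E t r lin2 subE.
- by move=> _ [[x y] /= [_ Bxy] <-]; rewrite -kerB.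
- exact: Er.
by apply/finite_dimensionalP; exact: subspace_lspan subE Ew.
Qed.

(** [T] has the same image on [M] as on [M + ker T], which is closed since [ker T] is
    finite-dimensional. Bounded preimages turn convergence of [T m] to [T x] into approximation of
    [x] by elements of [M + ker T]. *)
Lemma closed_image (X : completeNormedModType R[i]) (T : bop X X) (M : set X) :
  upper_semi_fredholm T -> closed M -> is_subspace M -> closed (T @` M).
Proof.
move=> [clT /finite_dimensionalP[s kerT]] clM subM.
have /closed_rnormP clMs := @closed_lspan _ _ _ s clM subM.
have [K K0 KP] := open_mapping closedT subspaceT clT.
apply/closed_rnormP => y yM.
have [x _ xy] : range T y.
  move/closed_rnormP: clT; apply=> e /yM[_ [m Mm <-] me].
  by exists (T m) => //; exists m.
have /lspanP[k] : lspan M s x.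
  apply: clMs => e e0.
  have [|_ [m Mm <-] me] := yM (e / (K + 1)).
    by rewrite divr_gt0// ltr_wpDl.
  have [|z [_ zx zK]] := KP (T (x - m)); first by exists (x - m).
  exists (x - z); last first.
    rewrite opprB addrC subrK (le_lt_trans zK)// linearB /= xy.
    move: me; rewrite ltr_pdivlMr ?ltr_wpDl//.
    by have := rnorm_ge0 (y - T m); lra.
  apply/lspanP; exists (x - m - z); last by rewrite opprB subrKA subKr.
  by rewrite -kerT /= linearB /= zx subrr.
rewrite -kerT /= => Tk Mxk; exists (x - k) => //.
by rewrite linearB /= Tk subr0.
Qed.

(* Infinite ascent makes [ker S] meet the subspace [Z], the intersection of the
   ranges of the powers of [S]; as [Z] is closed and [S] maps [Z] onto itself,
   the open mapping theorem bounds the preimages chosen in [Z]. *)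
Lemma backward_orbit (X : completeNormedModType R[i]) (S : bop X X) :
  upper_semi_fredholm S -> ~ finite_ascent S ->
  exists (a : nat -> X) (C q : R), [/\ 0 < q, geo C q a, a 0%N <> 0,
    S (a 0%N) = 0 & forall n, S (a n.+1) = a n].
Proof.
move=> usf nasc; have [_ /finite_dimensionalP[s kerS]] := usf.
pose Rn n : set X := range (iter n S).
have RnS n : Rn n.+1 = S @` Rn n.
  apply/seteqP; split=> [_ [x _ <-]|_ [_ [x _ <-] <-]].
    by exists (iter n S x) => //; exists x.
  by exists x.
have clsub n : closed (Rn n) /\ is_subspace (Rn n).
  elim: n => [|n [clRn subRn]].
    have -> : Rn 0%N = setT by apply/seteqP; split=> // x _; exists x.
    by split; [exact: closedT|exact: subspaceT].
  rewrite RnS; split; first exact: closed_image.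
  exact: subspace_image.
have RnSn n : Rn n.+1 `<=` Rn n.
  by move=> _ [x _ <-]; exists (S x) => //; rewrite iterSr.
have subK := kernel_subspace S.
pose E n := [set x | S x = 0] `&` Rn n.
have [n|n||N NP] := @subspace_stabilize _ _ s E.
- exact: subspaceI subK (clsub n).2.
- exact: setIS.
- by rewrite -kerS; exact: subIsetl.
have decR m n : (m <= n)%N -> Rn n `<=` Rn m.
  elim: n => [|n IH]; first by rewrite leqn0 => /eqP ->.
  rewrite leq_eqVlt => /predU1P[->//|mn]; exact: (subset_trans (RnSn n) (IH mn)).
have E_inf x : E N x -> forall n, Rn n x.
  move=> Ex n; apply: (decR n (maxn N n)); first exact: leq_maxr.
  exact: (NP _ (leq_maxl N n) _ Ex).2.
pose Z : set X := [set x | forall n, Rn n x].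
(* If [ker S] met [Z] only in 0, any [x] killed by the power [N.+1] would have [iter N S x] in
   [E N], hence in [Z], hence zero: the ascent would be at most [N]. *)
have [x0 [Sx0 Zx0 x0N0]] : exists x0, [/\ S x0 = 0, Z x0 & x0 <> 0].
  apply: contrapT => nx0; apply: nasc; apply: (@finite_ascent_intro _ _ N) => x Sx.
  apply: contrapT => SNx; apply: nx0; exists (iter N S x); split=> //.
  by apply: E_inf; split=> //; exists x.
have subZ : is_subspace Z.
  split=> [n|a x y Zx Zy n]; first exact: (clsub n).2.1.
  exact: (clsub n).2.2.
have clZ : closed Z.
  apply/closed_rnormP => x xZ n; have [/closed_rnormP clRn _] := clsub n.
  by apply: clRn => e /xZ[y Zy xy]; exists y.
have SZ : S @` Z = Z.
  apply/seteqP; split=> [_ [x Zx <-] n|z Zz].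
    by apply: RnSn; rewrite RnS; exists x.
  (* Any preimage in [Rn N] is already in [Z]: it differs from a preimage [y] in a deeper range by
     an element of [E N], which lies in every range. *)
  have := Zz N.+1; rewrite RnS => -[x RNx Sx]; exists x => // n.
  apply: (decR n (maxn N n)); first exact: leq_maxr.
  have := Zz (maxn N n).+1; rewrite RnS => -[y Ry Sy].
  have sub := (clsub (maxn N n)).2.
  rewrite -[x](subrK y); apply: subspaceD => //.
  apply: E_inf; split; first by rewrite /= linearB /= Sx Sy subrr.
  apply: subspaceB => //; first exact: (clsub N).2.
  exact: (decR N (maxn N n) (leq_maxl _ _)).
have clSZ : closed (S @` Z) by rewrite SZ.
have [K K0 KP] := open_mapping clZ subZ clSZ.
have /choice[G GP] z : exists x, Z z -> [/\ Z x, S x = z & rnorm x <= K * rnorm z].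
  have [Zz|?] := pselect (Z z); last by exists 0.
  by have [|x xP] := KP z; [rewrite SZ|exists x].
pose a n := iter n G x0.
have Za n : Z (a n) by elim: n => // n IH; have [] := GP _ IH.
have Sa n : S (a n.+1) = a n by have [] := GP _ (Za n).
pose q := K + 1; have q0 : 0 < q by rewrite ltr_wpDl.
have aq : geo (rnorm x0) q a.
  elim=> [|n IH]; first by rewrite expr0 mulr1.
  have [_ _ /le_trans le] := GP _ (Za n); apply: le.
  rewrite exprSr mulrA [leRHS]mulrC ler_pM ?rnorm_ge0//.
  by rewrite lerDl.
by exists a, (rnorm x0), q.
Qed.

Lemma upper_semi_fredholm_SVEP (X : completeNormedModType R[i]) (T : bop X X)
    (l : R[i]) :
  upper_semi_fredholm (sub_scalar T l) -> SVEP T l ->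
  finite_ascent (sub_scalar T l).
Proof.
move=> usf svep; apply: contrapT => nasc.
have [a [C [q [q0 aq a0 Sa0 SaS]]]] := backward_orbit usf nasc.
have qge0 := ltW q0.
(* On this disc the function [psum a (z - l)] violates SVEP, as its value at [l] is [a 0%N]. *)
have disc z : open_disc l (2^-1 / q) z -> rnorm (z - l) * q < 2^-1.
  by rewrite /open_disc /= rnormE ltcR ltr_pdivlMr.
have r0 : 0 < 2^-1 / q by rewrite divr_gt0.
apply: a0; rewrite -(psum0 qge0 aq) -(subrr l).
apply: (svep _ r0 (fun z => psum a (z - l))) => [z /disc zl|z /disc/ltW zl|].
- have := psum_derivable q0 zl aq; rewrite /derivable.
  have -> // :
    (fun h : R[i]^o => h^-1 *:
      ((psum a \o shift (z - l)) (h *: 1) - psum a (z - l))) =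
    (fun h : R[i]^o => h^-1 *:
      (((fun z => psum a (z - l)) \o shift z) (h *: 1) - psum a (z - l))).
  by apply/funext => h; rewrite /= /shift addrA.
- have := psum_eigenvector qge0 zl aq Sa0 SaS.
  rewrite !sub_scalarE scalerBl => /eqP; rewrite subr_eq subrK => /eqP ->.
  by rewrite subrr.
by rewrite /open_disc /= subrr normr0 ltcR.
Qed.

End Operators.

Theorem proposition2p2 (R : realType) (X : completeNormedModType R[i])
    (A B C : bop X X) :
  sigma_ab (upper_triangular A C B) `<=` sigma_ab (direct_sum A B) /\
  sigma_ab (direct_sum A B) `<=`
    sigma_ab (upper_triangular A C B) `|` (Xi_plus_star A `|` Xi_plus B).
Proof.
rewrite -upper_triangular0; split=> l; apply: contraPP => /=.
  move/sigma_abP; rewrite sub_scalar_upper_triangular => -[M0 asc0].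
  have [uA uB] := upper_semi_fredholm_direct_sum M0.
  apply/sigma_abP; rewrite sub_scalar_upper_triangular; split.
    exact: upper_semi_fredholm_upper_triangular.
  apply: finite_ascent_upper_triangular.
    exact: finite_ascent_upper_triangularl asc0.
  exact: finite_ascent_upper_triangularr asc0.
(* Off the right-hand side, finite ascent of [A - l] comes from the triangular operator and that of
   [B - l] from SVEP; together they give the diagonal operator finite ascent. *)
move=> /not_orP[/sigma_abP + /not_orP[]].
move=> + /not_orP[/contrapT uA _] /not_orP[/contrapT uB /contrapT svepB].
rewrite sub_scalar_upper_triangular => -[_ asc].
apply/sigma_abP; rewrite sub_scalar_upper_triangular; split.
  exact: upper_semi_fredholm_upper_triangular.
apply: finite_ascent_upper_triangular.
  exact: finite_ascent_upper_triangularl asc.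
exact: upper_semi_fredholm_SVEP.
Qed.
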